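(* For $n\ge1$, the Laplacian simplex $T_{K_n}$ of the complete graph $K_n$ is reflexive.
   Context: For a connected graph $G$ on vertex set $[n]$, its Laplacian $L$ has $L_{ii}=\deg(i)$, $L_{ij}=-1$ if $\{i,j\}$ is an edge and $0$ otherwise. Let $A$ be the $n\times(n-1)$ matrix with $a_{ij}=1$ if $i\le j\le n-1$ and $0$ otherwise, and $L_B=LA$. The Laplacian simplex $T_G\subseteq\mathbb{R}^{n-1}$ is the convex hull of the rows of $L_B$. A full-dimensional lattice polytope $P$ is reflexive if it contains the origin in its interior and its dual $P^*=\{x:x\cdot y\le1\ \forall y\in P\}$ is a lattice polytope. *)

(* Defs.v *)
From HB Require Import structures.
From mathcomp Require Import all_boot all_order all_algebra.
From mathcomp Require Import all_classical all_reals all_analysis.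

Set Implicit Arguments.
Unset Strict Implicit.
Unset Printing Implicit Defensive.

Import Order.TTheory GRing.Theory Num.Theory.
Import numFieldNormedType.Exports.

Local Open Scope classical_set_scope.
Local Open Scope ring_scope.

Record connected_graph (n : nat) := ConnectedGraph {
  edge : rel 'I_n;
  edge_sym : symmetric edge;
  edge_irr : irreflexive edge;
  edge_connected : forall i j, connect edge i j
}.

Definition degree n (G : connected_graph n) (i : 'I_n) : nat :=
  #|[pred j | edge G i j]|.

Definition laplacian n (G : connected_graph n) : 'M[int]_n :=
  \matrix_(i, j)
    if i == j then (degree G i)%:Z else if edge G i j then -1 else 0.

(* Indices start at 0 here; shifting both of them by one preserves i <= j,
   and j : 'I_n.-1 is the constraint j <= n - 1 on 1-based column indices. *)
Definition Amx (n : nat) : 'M[int]_(n, n.-1) :=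
  \matrix_(i < n, j < n.-1) if (i <= j)%N then 1 else 0.

Definition laplacianB n (G : connected_graph n) : 'M[int]_(n, n.-1) :=
  laplacian G *m Amx n.

Section polytopes.
Variables (R : realType) (d : nat).
Implicit Type P : set 'rV[R]_d.

Definition conv_rows k (V : 'M[R]_(k, d)) : set 'rV[R]_d :=
  [set x | exists t : 'I_k -> R,
     [/\ forall i, 0 <= t i, \sum_i t i = 1 & x = \sum_i t i *: row i V]].

Definition affine_hull P : set 'rV[R]_d :=
  [set x | exists (k : nat) (v : 'I_k -> 'rV[R]_d) (t : 'I_k -> R),
     [/\ forall i, P (v i), \sum_i t i = 1 & x = \sum_i t i *: v i]].

Definition full_dimensional P : Prop := affine_hull P = setT.

Definition lattice_polytope P : Prop :=
  exists (k : nat) (V : 'M[int]_(k, d)), P = conv_rows (map_mx intr V).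

Definition dual_polytope P : set 'rV[R]_d :=
  [set x | forall y, P y -> \sum_i x 0 i * y 0 i <= 1].

Definition reflexive_polytope P : Prop :=
  [/\ lattice_polytope P, full_dimensional P, (interior P) 0
    & lattice_polytope (dual_polytope P)].

End polytopes.

Definition laplacian_simplex (R : realType) n (G : connected_graph n) :
  set 'rV[R]_n.-1 := conv_rows (map_mx intr (laplacianB G)).
Arguments laplacian_simplex R {n} G _.

Section complete_graph.
Variable n : nat.

Definition complete_edge : rel 'I_n := [rel i j | i != j].

Lemma complete_edge_sym : symmetric complete_edge.
Proof. by move=> i j; rewrite /complete_edge /= eq_sym. Qed.

Lemma complete_edge_irr : irreflexive complete_edge.
Proof. by move=> i; rewrite /complete_edge /= eqxx. Qed.

Lemma complete_edge_connected i j : connect complete_edge i j.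
Proof.
by case: (eqVneq i j) => [->|ij]; [exact: connect0 | exact: connect1].
Qed.

Definition complete_graph : connected_graph n :=
  ConnectedGraph complete_edge_sym complete_edge_irr complete_edge_connected.

End complete_graph.

(* Main.v *)
Require Import Defs.
From HB Require Import structures.
From mathcomp Require Import all_boot all_order all_algebra.
From mathcomp Require Import all_classical all_reals all_analysis.
From mathcomp Require Import ring.

(** The rows of [L_B] are [v_i = n e_{>= i} - (1, ..., n-1)], and the simplex
    with vertices [u_k = e_{k-1} - e_k] (where [e_{-1} = e_{n-1} = 0]) is
    dual to [T_{K_n}]: both families of vertices sum to zero and
    [U^T V = - n I].  This already forces [v_i . u_k = 1 - n [i = k]], since it
    says that the square matrices [(1 | V)] and [(1 | - U)^T] are inverse up to
    the factor [n].  Hence [(1 - y . u_k) / n] are the barycentric coordinates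
    of [y] with respect to the [v_k], so the facets of [conv V] are given by the
    integral inequalities [y . u_k <= 1], and symmetrically in [U] and [V]. *)

Set Implicit Arguments.
Unset Strict Implicit.
Unset Printing Implicit Defensive.

Import Order.TTheory GRing.Theory Num.Theory.
Import numFieldNormedType.Exports.

Local Open Scope classical_set_scope.
Local Open Scope ring_scope.

Section polar_simplices.
Variables (R : realType) (d : nat).
Implicit Types U V : 'M[R]_(1 + d, d).

Definition polar_pair U V : Prop :=
  [/\ const_mx 1 *m U = 0 :> 'rV_d, const_mx 1 *m V = 0 :> 'rV_d
    & U^T *m V = - (d.+1%:R)%:M].

Lemma polar_pairC U V : polar_pair U V -> polar_pair V U.
Proof.
move=> [U0 V0 UV]; split=> //.
by rewrite -[V^T *m U]trmxK trmx_mul trmxK UV linearN /= tr_scalar_mx.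
Qed.

Lemma natS_neq0 : d.+1%:R != 0 :> R.
Proof. by rewrite pnatr_eq0. Qed.

Lemma polar_pair_mulmx_tr U V : polar_pair U V ->
  V *m U^T = const_mx 1 - (d.+1%:R)%:M.
Proof.
move=> [U0 V0 UV].
have trc1 p q : (const_mx 1 : 'M[R]_(p, q))^T = const_mx 1.
  by apply/matrixP => i j; rewrite !mxE.
have U0' : U^T *m const_mx 1 = 0 :> 'cV_d.
  by apply: trmx_inj; rewrite trmx_mul trmxK trc1 U0 trmx0.
pose V' : 'M[R]_(1 + d) := row_mx (const_mx 1) V.
pose U' : 'M[R]_(1 + d) := col_mx (const_mx 1) (- U^T).
have c11 : (const_mx 1 : 'rV_(1 + d)) *m (const_mx 1 : 'cV_(1 + d)) =
    (d.+1%:R)%:M :> 'M[R]_1.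
  apply/matrixP => i j; rewrite !ord1 !mxE.
  under eq_bigr do rewrite !mxE mulr1.
  by rewrite sumr_const card_ord.
have UV' : (d.+1%:R^-1 *: U') *m V' = 1%:M.
  rewrite -scalemxAl /U' /V' mul_col_row V0 mulNmx U0' oppr0 mulNmx UV opprK.
  rewrite c11 -scalar_mx_block.
  by rewrite scale_scalar_mx mulVf ?natS_neq0.
(* A left inverse of a square matrix is a right inverse; the product in the opposite order is
   [1 1^T - V U^T] up to scale, which yields [V U^T]. *)
have := mulmx1C UV'.
rewrite -scalemxAr /V' /U' mul_row_col mulmxN.
move=> /(congr1 (fun M => d.+1%:R *: M)).
rewrite scalerA mulfV ?natS_neq0// scale1r scale_scalar_mx mulr1 => <-.
rewrite opprB addrC.
have -> : (const_mx 1 : 'cV_(1 + d)) *m (const_mx 1 : 'rV_(1 + d)) =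
    const_mx 1 :> 'M[R]_(1 + d).
  by apply/matrixP => i j; rewrite !mxE big_ord1 !mxE mulr1.
by rewrite subrK.
Qed.

Definition barycentric U (y : 'rV[R]_d) (k : 'I_(1 + d)) : R :=
  (1 - (y *m U^T) 0 k) / d.+1%:R.

Lemma sum_barycentric U V y : polar_pair U V -> \sum_k barycentric U y k = 1.
Proof.
move=> [U0 _ _]; rewrite -mulr_suml sumrB sumr_const card_ord.
have -> : \sum_k (y *m U^T) 0 k =
    ((const_mx 1 : 'rV_(1 + d)) *m U *m y^T) 0 0.
  rewrite -mulmxA mxE; apply: eq_bigr => k _.
  by rewrite -[U *m _]trmxK trmx_mul trmxK !mxE mul1r.
by rewrite U0 mul0mx mxE subr0 mulfV ?natS_neq0.
Qed.

(** The constant terms cancel because the rows of [V] sum to zero, and the linear part is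
    [- y (U^T V) / (d + 1) = y]. *)
Lemma barycentricK U V y : polar_pair U V ->
  \sum_k barycentric U y k *: row k V = y.
Proof.
move=> [_ V0 UV].
have -> : \sum_k barycentric U y k *: row k V =
    d.+1%:R^-1 *: ((const_mx 1 - y *m U^T) *m V).
  rewrite mulmx_sum_row scaler_sumr; apply: eq_bigr => k _.
  by rewrite scalerA /barycentric mulrC !mxE.
by rewrite mulmxBl V0 sub0r -mulmxA UV mulmxN opprK mul_mx_scalar scalerA
  mulVf ?natS_neq0// scale1r.
Qed.

Lemma conv_rows_polar U V : polar_pair U V ->
  conv_rows V = [set y | forall k, (y *m U^T) 0 k <= 1].
Proof.
move=> UV; apply/seteqP; split=> [y [t [t0 t1 ->]] k|y yU]; last first.
  exists (barycentric U y); split; last by rewrite (barycentricK _ UV).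
  - by move=> k; rewrite divr_ge0// subr_ge0.
  - exact: sum_barycentric UV.
have -> : \sum_i t i *: row i V = (\row_i t i) *m V.
  by rewrite mulmx_sum_row; apply: eq_bigr => i _; rewrite mxE.
(* Coordinate [k] becomes [1 - (d + 1) t_k], so the facet inequality is exactly [0 <= t_k]. *)
rewrite -mulmxA (polar_pair_mulmx_tr UV) mulmxBr mul_mx_scalar !mxE.
under eq_bigr do rewrite !mxE mulr1.
by rewrite t1 lerBlDr lerDl mulr_ge0.
Qed.

Lemma row_conv_rows k (V : 'M[R]_(k, d)) i : conv_rows V (row i V).
Proof.
exists (fun j => (j == i)%:R); split=> [j||]; first exact: ler0n.
- rewrite (bigD1 i)//= eqxx big1 ?addr0// => j /negbTE ->; exact: erefl.
- rewrite (bigD1 i)//= eqxx scale1r big1 ?addr0// => j /negbTE ->.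
  by rewrite scale0r.
Qed.

(** A linear functional at a convex combination is the weighted average of its values at the rows,
    so the bound need only be tested there. *)
Lemma dual_conv_rows k (V : 'M[R]_(k, d)) :
  dual_polytope (conv_rows V) = [set x | forall i, (x *m V^T) 0 i <= 1].
Proof.
apply/seteqP; split=> [x xV i|x xV y [t [t0 t1 ->]]].
  rewrite mxE; apply: le_trans (xV _ (row_conv_rows V i)).
  by apply: ler_sum => j _; rewrite !mxE.
have -> : \sum_j x 0 j * (\sum_i t i *: row i V) 0 j
    = \sum_i t i * (x *m V^T) 0 i.
  under eq_bigr do rewrite summxE mulr_sumr.
  rewrite exchange_big; apply: eq_bigr => i _.
  by rewrite mxE mulr_sumr; apply: eq_bigr => j _; rewrite !mxE mulrCA.
rewrite -t1; apply: ler_sum => i _.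
by rewrite -[leRHS]mulr1; exact: ler_wpM2l.
Qed.

Lemma polar_pair_dual U V : polar_pair U V ->
  dual_polytope (conv_rows V) = conv_rows U.
Proof.
by move=> UV; rewrite dual_conv_rows (conv_rows_polar (polar_pairC UV)).
Qed.

Lemma polar_pair_full_dimensional U V : polar_pair U V ->
  full_dimensional (conv_rows V).
Proof.
move=> UV; apply/seteqP; split=> // y _.
exists (1 + d)%N, (fun i => row i V), (barycentric U y); split.
- by move=> i; exact: row_conv_rows.
- exact: sum_barycentric UV.
- by rewrite (barycentricK _ UV).
Qed.

(** Each of the finitely many facet inequalities is strict at the origin, [0 < 1], hence persists
    nearby by continuity. *)
Lemma polar_pair_interior U V : polar_pair U V ->
  (conv_rows V)^° 0.
Proof.
move=> UV; rewrite (conv_rows_polar UV) /interior.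
apply: (filter_forall (F := nbhs (0 : 'rV[R]_d))) => k.
have cU : continuous (fun y : 'rV[R]_d => (y *m U^T) 0 k).
  have -> : (fun y : 'rV[R]_d => (y *m U^T) 0 k) =
      (fun y => \sum_j y 0 j * U k j).
    by apply/funext => y; rewrite mxE; apply: eq_bigr => j _; rewrite mxE.
  apply: (continuous_big (op := +%R)) => [|j _ y]; first exact: add_continuous.
  apply: cvgM; [exact: nbhs_filter | exact: (@coord_continuous R 1 d 0 j y) |].
  exact: (@cvg_cst R _ _ _ (nbhs_filter y)).
apply: (cvgr_le _ (cU 0)).
by rewrite mul0mx mxE.
Qed.

End polar_simplices.

(** Integrality of [V] makes the polytope a lattice polytope; that of [U] does the same for the
    dual. *)
Lemma reflexive_conv_rows (R : realType) d (U V : 'M[int]_(1 + d, d)) :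
  const_mx 1 *m U = 0 :> 'rV_d -> const_mx 1 *m V = 0 :> 'rV_d ->
  U^T *m V = - (d.+1%:R)%:M ->
  reflexive_polytope (conv_rows (map_mx intr V : 'M[R]_(1 + d, d))).
Proof.
move=> U0 V0 UV.
have c1 : const_mx 1 = map_mx intr (const_mx 1) :> 'rV[R]_(1 + d).
  by apply/matrixP => i j; rewrite !mxE.
have UVR : polar_pair (map_mx intr U) (map_mx intr V : 'M[R]_(1 + d, d)).
  split; first by rewrite c1 -map_mxM U0 map_mx0.
    by rewrite c1 -map_mxM V0 map_mx0.
  by rewrite map_trmx -map_mxM UV map_mxN map_scalar_mx /= rmorph_nat.
split.
- by exists (1 + d)%N, V.
- exact: polar_pair_full_dimensional UVR.
- exact: polar_pair_interior UVR.
- by exists (1 + d)%N, U; exact: polar_pair_dual.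
Qed.

Lemma laplacian_complete_graph n (i j : 'I_n) :
  laplacian (complete_graph n) i j = (n * (i == j))%:Z - 1.
Proof.
rewrite mxE /=; have [->|ij] := eqVneq i j.
  (* The ordinal [j] excludes [n = 0], so the truncated [n.-1] is the true [n - 1]. *)
  have n0 : (0 < n)%N by exact: leq_ltn_trans (ltn_ord j).
  have -> : degree (complete_graph n) j = n.-1.
    rewrite -[in RHS](card_ord n) -(cardC1 j); apply: eq_card => k.
    by rewrite !inE /= eq_sym.
  by rewrite muln1 -subn1 subzn.
by rewrite /complete_edge /= ij muln0.
Qed.

Lemma sum_ord_leq n j : (j < n)%N ->
  \sum_(i < n) (i <= j)%N%:R = j.+1%:R :> int.
Proof.
move=> jn; rewrite -natr_sum -big_mkcond /=.
by rewrite -(big_ord_widen _ (fun=> 1%N) jn) sum1_card card_ord.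
Qed.

(** Since [L = n I - J] with [J] all ones, [L A] is [n A] minus the column sums of [A], which are
    [j + 1] for 0-based [j]. *)
Lemma laplacianB_complete_graph n (i : 'I_n) (j : 'I_n.-1) :
  laplacianB (complete_graph n) i j = n%:Z * (i <= j)%N%:R - j.+1%:Z.
Proof.
rewrite mxE.
under eq_bigr do rewrite laplacian_complete_graph !mxE mulrBl mul1r.
rewrite sumrB (bigD1 i)//= big1 => [|k /negbTE ki]; last first.
  by rewrite eq_sym ki muln0 mul0r.
rewrite eqxx muln1 addr0; congr (_ - _); first by case: ifP.
have jn : (j < n)%N by exact: leq_trans (ltn_ord j) (leq_pred n).
by rewrite -[RHS]natz -(sum_ord_leq jn); apply: eq_bigr => k _; case: ifP.
Qed.

(* Row [k] is [e_{k-1} - e_k], with the nonexistent basis vectors zero. *)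
Definition path_incidence d : 'M[int]_(1 + d, d) :=
  \matrix_(k, j) ((k == lift ord0 j)%:R - (k == widen_ord (leqnSn d) j)%:R).

(** The transpose acts as a difference operator on consecutive rows: the two indices have values
    [i + 1] and [i]. *)
Lemma path_incidence_mul d m (M : 'M[int]_(1 + d, m)) i j :
  ((path_incidence d)^T *m M) i j =
    M (lift ord0 i) j - M (widen_ord (leqnSn d) i) j.
Proof.
have sum_delta (a : 'I_(1 + d)) : \sum_k (k == a)%:R * M k j = M a j.
  rewrite (bigD1 a)//= eqxx mul1r big1 ?addr0// => k /negbTE ->.
  exact: mul0r.
rewrite mxE; under eq_bigr do rewrite !mxE mulrBl.
by rewrite sumrB !sum_delta.
Qed.

Theorem theorem6p1 (R : realType) (n : nat) (hn : (1 <= n)%N) :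
  reflexive_polytope (laplacian_simplex R (complete_graph n)).
Proof.
case: n hn => // d _.
apply: (@reflexive_conv_rows R d (path_incidence d)).
(* Transposed, the sum of the rows is the difference operator applied to a constant column. *)
- apply: trmx_inj; rewrite trmx_mul trmx0; apply/matrixP => i j.
  by rewrite path_incidence_mul !mxE subrr.
- apply/matrixP => i j; rewrite mxE.
  under eq_bigr do rewrite mxE mul1r laplacianB_complete_graph.
  rewrite sumrB -mulr_sumr sum_ord_leq; last exact: ltnW (ltn_ord j).
  by rewrite sumr_const card_ord -[X in _ - X]mulr_natl !natz subrr mxE.
- apply/matrixP => i j.
  rewrite path_incidence_mul !laplacianB_complete_graph /=.
  rewrite !mxE -mulr_natr natz /bump leq0n add1n.
  (* The terms [j + 1] cancel in the difference, and [[i < j] - [i <= j] = - [i = j]]. *)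
  rewrite [(i <= j)%N]leq_eqVlt -val_eqE /=.
  by case: ltngtP => //= _; ring.
Qed.
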